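(* Let $n\ge 2$, let $A=(a_{ij})\in\operatorname{GL}_n(\mathbb{R})$ with row vectors $\boldsymbol a_1,\dots,\boldsymbol a_n$, and let $L=A\mathbb{Z}^n$. Fix a $\mathbb{Z}$-basis $\boldsymbol\alpha$ of the additive group $\langle L\rangle$, and let $\mu(\boldsymbol\alpha)$ be as defined in the context. Let $1\le k<n$ and suppose that there exists a subset $I\subset\{1,\dots,n\}$ of $n-k$ distinct indices such that $d_I(A)<n$. Let $\ell=n-d_I(A)$. Then $s_\ell(L)\le k$, and there exist $\ell$ linearly independent vectors $\boldsymbol x_1,\dots,\boldsymbol x_\ell\in L$ with $\|\boldsymbol x_i\|_0\le k$ for all $i$ and $$\prod_{i=1}^{\ell}|\boldsymbol x_i|\le n^{\,n-d_I(A)/2}\,|A|^{n}\,\mu(\boldsymbol\alpha)^{d_I(A)}.$$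
   Context: For $\boldsymbol x\in\mathbb{R}^n$, $|\boldsymbol x|=\max_i|x_i|$ is the sup-norm and $\|\boldsymbol x\|_0$ is the number of nonzero coordinates of $\boldsymbol x$; a vector is $m$-sparse if $\|\boldsymbol x\|_0\le m$. For $A=(a_{ij})$, $|A|=\max_{i,j}|a_{ij}|$. For a full-rank lattice $L\subset\mathbb{R}^n$ and $1\le i\le n$, the $i$-th successive sparsity level $s_i(L)$ is the minimal $s$ such that $L$ contains $i$ linearly independent vectors each with $\|\cdot\|_0\le s$. For a nonzero vector $\boldsymbol x\in\mathbb{R}^n$, its rational dimension is $d(\boldsymbol x)=\dim_{\mathbb{Q}}\operatorname{span}_{\mathbb{Q}}\{x_1,\dots,x_n\}$. For $I\subseteq\{1,\dots,n\}$, $d_I(A)=\sum_{i\in I}d(\boldsymbol a_i)$, where $\boldsymbol a_i$ are the rows of $A$. $\langle L\rangle$ denotes the additive subgroup of $\mathbb{R}$ generated by all coordinates of all vectors of $L$; it is free abelian of some finite rank $m$. Given a $\mathbb{Z}$-basis $\boldsymbol\alpha=(\alpha_1,\dots,\alpha_m)$ of $\langle L\rangle$, each $\boldsymbol x\in L$ can be written uniquely as $\boldsymbol x=\sum_{i=1}^m\alpha_i\boldsymbol f_i$ with $\boldsymbol f_i\in\mathbb{Z}^n$; define $\Phi_{\boldsymbol\alpha}(\boldsymbol x)\in\mathbb{R}^{nm}$ to be the vector obtained by stacking $\boldsymbol f_1,\dots,\boldsymbol f_m$. This map is additive and extends $\mathbb{R}$-linearly to $\Phi_{\boldsymbol\alpha}:\mathbb{R}^n=\mathbb{R}\otimes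 L\to\mathbb{R}^{nm}$. Set $|\boldsymbol x|_{\Phi_{\boldsymbol\alpha}}=|\Phi_{\boldsymbol\alpha}(\boldsymbol x)|$ (sup-norm in $\mathbb{R}^{nm}$) and $\mu(\boldsymbol\alpha)=\sup\{|\boldsymbol x|_{\Phi_{\boldsymbol\alpha}}/|\boldsymbol x| : \boldsymbol x\in\mathbb{R}^n\setminus\{\boldsymbol 0\}\}$. *)

(* Defs.v *)
From mathcomp Require Import all_boot all_order all_algebra.
From mathcomp Require Import all_classical all_reals all_analysis.

Set Implicit Arguments.
Unset Strict Implicit.
Unset Printing Implicit Defensive.

Import Order.TTheory GRing.Theory Num.Theory.
Import numFieldNormedType.Exports.

Local Open Scope classical_set_scope.
Local Open Scope ring_scope.

(* The norm `|x| of a vector or a matrix is the entrywise maximum (mx_norm). *)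

Section Sparsity.
Context {R : realType} {n : nat}.

Definition norm0 (x : 'cV[R]_n) : nat := #|[set i | x i ord0 != 0]%SET|.

Definition sparse (k : nat) (x : 'cV[R]_n) : Prop := (norm0 x <= k)%N.

Definition lattice_of (A : 'M[R]_n) : set 'cV[R]_n :=
  [set A *m map_mx intr z | z in [set: 'cV[int]_n]].

Definition has_sparse_free (L : set 'cV[R]_n) (i s : nat) : Prop :=
  exists x : 'I_i -> 'cV[R]_n,
    [/\ forall j, L (x j), free [tuple x j | j < i] & forall j, sparse s (x j)].

(* Every vector is n-sparse, so the minimum can be taken over s <= n; it is
   attained as soon as L contains i linearly independent vectors (the value
   is n otherwise). *)
Definition sparsity_level (L : set 'cV[R]_n) (i : nat) : nat :=
  [arg min_(s < (ord_max : 'I_n.+1) | `[< has_sparse_free L i s >]) (s : nat)].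

End Sparsity.

Section RationalDimension.
Context {R : realType}.

Definition rat_span (n : nat) (x : 'I_n -> R) : set R :=
  [set \sum_(i < n) ratr (c i) * x i | c in [set: 'I_n -> rat]].

Definition rat_free (n : nat) (x : 'I_n -> R) : Prop :=
  forall c : 'I_n -> rat,
    \sum_(i < n) ratr (c i) * x i = 0 -> forall i, c i = 0.

(* The number of elements of a finite Q-basis of V, or 0 if there is none. *)
Definition rat_dim (V : set R) : nat :=
  xget 0%N [set d | exists b : 'I_d -> R, rat_free b /\ rat_span b = V].

Definition rational_dim (n : nat) (x : 'rV[R]_n) : nat :=
  rat_dim (rat_span (x ord0)).

Definition rational_dim_rows (m n : nat) (A : 'M[R]_(m, n)) (I : {set 'I_m})
  : nat := (\sum_(i in I) rational_dim (row i A))%N.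

End RationalDimension.

Section CoordinateGroup.
Context {R : realType} {n : nat}.
Implicit Types L : set 'cV[R]_n.

Definition coord_group L : set R :=
  smallest (fun H : set R => zmod_closed (mem H))
    [set x i ord0 | x in L & i in [set: 'I_n]].

Definition int_basis (m : nat) (G : set R) (alpha : 'I_m -> R) : Prop :=
  (forall c : 'I_m -> int,
     \sum_(i < m) alpha i *~ c i = 0 -> forall i, c i = 0) /\
  [set \sum_(i < m) alpha i *~ c i | c in [set: 'I_m -> int]] = G.

(* An m-tuple (f_1, ..., f_m) of integer vectors of length n is represented by
   the m x n matrix F whose i-th row is f_i. *)
Definition int_comb (m : nat) (alpha : 'I_m -> R) (F : 'M[int]_(m, n))
  : 'cV[R]_n := \sum_(i < m) alpha i *: (map_mx intr (row i F))^T.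

Definition stack_rows (m : nat) (F : 'M[int]_(m, n)) : 'cV[R]_(m * n) :=
  (mxvec (map_mx intr F))^T.

Definition Phi_lattice (m : nat) (alpha : 'I_m -> R) (x : 'cV[R]_n)
  : 'cV[R]_(m * n) :=
  stack_rows (xget 0 [set F : 'M[int]_(m, n) | x = int_comb alpha F]).

(* The R-linear extension of Phi_lattice from L to the whole space; it exists
   and is unique when L is a full-rank lattice and alpha is an int_basis of
   coord_group L. *)
Definition Phi L (m : nat) (alpha : 'I_m -> R)
  : 'Hom('cV[R]_n, 'cV[R]_(m * n)) :=
  xget 0 [set f : 'Hom('cV[R]_n, 'cV[R]_(m * n)) |
           forall x, L x -> f x = Phi_lattice alpha x].

Definition mu L (m : nat) (alpha : 'I_m -> R) : R :=
  sup [set `|Phi L alpha x| / `|x| | x in [set x : 'cV[R]_n | x != 0]].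

End CoordinateGroup.

(* Main.v *)
(* Writing a_ij in the basis alpha turns the condition (A z)_i = 0 for i in I into
   integer linear equations B z = 0; the coefficients of B are coordinates of
   Phi (A e_j), hence bounded by mu |A|, and alpha being rationally free bounds the
   rank of B by d_I(A).  The theorem is then Siegel's lemma in the form of Bombieri
   and Vaaler, for Euclidean norms of z: they satisfy |A z| <= sqrt n |A| |z|_2, and
   the loss sqrt n per vector is what the stated constant allows.  Siegel's lemma
   follows from Minkowski's theorem on linear forms, applied to independent rows of
   B together with forms coming from the successive minima of the integer points of
   ker B, the determinant of this system being bounded by Hadamard's inequality. *)

Require Import Defs.
From mathcomp Require Import all_boot all_order all_algebra.
From mathcomp Require Import all_classical all_reals all_analysis.
From mathcomp Require Import ring zify.

Set Implicit Arguments.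
Unset Strict Implicit.
Unset Printing Implicit Defensive.

Import Order.TTheory GRing.Theory Num.Theory.
Import numFieldNormedType.Exports.

Local Open Scope classical_set_scope.
Local Open Scope ring_scope.

(** * Euclidean product of row vectors, Gram determinants and Hadamard's inequality *)

Section RowDot.
Context {F : realFieldType}.

Definition rdot n (x y : 'rV[F]_n) : F := (x *m y^T) 0 0.

Lemma rdotE n (x y : 'rV[F]_n) : rdot x y = \sum_j x 0 j * y 0 j.
Proof. by rewrite /rdot mxE; apply: eq_bigr => j _; rewrite mxE. Qed.

Lemma rdotC n (x y : 'rV[F]_n) : rdot x y = rdot y x.
Proof. by rewrite !rdotE; apply: eq_bigr => j _; rewrite mulrC. Qed.

Lemma rdotDl n (x y z : 'rV[F]_n) : rdot (x + y) z = rdot x z + rdot y z.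
Proof. by rewrite /rdot mulmxDl mxE. Qed.

Lemma rdotZl n a (x y : 'rV[F]_n) : rdot (a *: x) y = a * rdot x y.
Proof. by rewrite /rdot -scalemxAl mxE. Qed.

Lemma rdotDr n (x y z : 'rV[F]_n) : rdot z (x + y) = rdot z x + rdot z y.
Proof. by rewrite rdotC rdotDl !(rdotC z). Qed.

Lemma rdotZr n a (x y : 'rV[F]_n) : rdot x (a *: y) = a * rdot x y.
Proof. by rewrite rdotC rdotZl rdotC. Qed.

Lemma rdot_ge0 n (x : 'rV[F]_n) : 0 <= rdot x x.
Proof. by rewrite rdotE; apply: sumr_ge0 => j _; rewrite -expr2 sqr_ge0. Qed.

Lemma rdot_eq0 n (x : 'rV[F]_n) : (rdot x x == 0) = (x == 0).
Proof.
apply/eqP/eqP => [|->]; last by rewrite /rdot mul0mx mxE.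
rewrite rdotE => /eqP; rewrite psumr_eq0 => [/allP h|j _]; last first.
  by rewrite -expr2 sqr_ge0.
apply/rowP => j; rewrite mxE; apply/eqP.
by have := h j (mem_index_enum j); rewrite /= -expr2 sqrf_eq0.
Qed.

Lemma rdot_gt0 n (x : 'rV[F]_n) : (0 < rdot x x) = (x != 0).
Proof. by rewrite lt_def rdot_eq0 rdot_ge0 andbT. Qed.

Lemma gram_col0_mx p n (N : 'M[F]_(p, n)) :
  \det (col_mx (0 : 'rV_n) N *m (col_mx (0 : 'rV_n) N)^T) = 0.
Proof.
rewrite tr_col_mx mul_col_row trmx0 mulmx0 !mul0mx.
by rewrite det_lblock det_mx11 mxE mul0r.
Qed.

(** Subtracting multiples of [u] from the other rows is left multiplication by the unipotent [T],
    which preserves the Gram determinant; orthogonality of [N'] to [u] then makes the Gram matrix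
    block diagonal. *)
Lemma gram_col_mx p n (u : 'rV[F]_n) (N N' : 'M[F]_(p, n)) (c : 'cV[F]_p) :
  N = N' + c *m u -> N' *m u^T = 0 ->
  \det (col_mx u N *m (col_mx u N)^T) = rdot u u * \det (N' *m N'^T).
Proof.
move=> -> N'u; set M := col_mx u _.
have uuE : u *m u^T = (rdot u u)%:M by rewrite [LHS]mx11_scalar.
pose T : 'M[F]_(1 + p) := block_mx 1%:M 0 (- c) 1%:M.
have detT : \det T = 1 by rewrite /T det_lblock !det1 mulr1.
have TM : T *m M = col_mx u N'.
  by rewrite /T /M mul_block_col !mul1mx mul0mx addr0 mulNmx addrC addrK.
have -> : \det (M *m M^T) = \det ((T *m M) *m (T *m M)^T).
  rewrite trmx_mul mulmxA -(mulmxA T).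
  by rewrite !det_mulmx det_tr detT mul1r mulr1.
rewrite TM tr_col_mx mul_col_row N'u uuE.
have -> : u *m N'^T = 0 by rewrite -[LHS]trmxK trmx_mul trmxK N'u trmx0.
by rewrite det_lblock det_scalar1.
Qed.

(** Gram-Schmidt, one row at a time: the rows below [u] are replaced by their components orthogonal
    to [u], which are no longer than the rows themselves. The Gram matrix allows a rectangular [M],
    as the induction removes rows but no columns. *)
Lemma hadamard_gram p n (M : 'M[F]_(p, n)) :
  \det (M *m M^T) <= \prod_i rdot (row i M) (row i M).
Proof.
elim: p M => [|p IHp] M; first by rewrite det_mx00 big_ord0.
rewrite -(vsubmxK (M : 'M[F]_(1 + p, n))).
move: (usubmx _) (dsubmx _) => u N {M}.
set M := col_mx u N.
rewrite big_ord_recl.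
have -> : row 0 M = u.
  apply/rowP => j; rewrite mxE -[RHS](col_mxEu u N) (_ : lshift p 0 = 0) //.
  exact: val_inj.
have rowM i : row (lift ord0 i) M = row i N.
  by apply/rowP => j; rewrite -rshift1 [LHS]mxE [RHS]mxE (col_mxEd u N).
under eq_bigr do rewrite rowM.
case: (altP (u =P 0)) => [u0|u_neq0].
  rewrite /M u0 (gram_col0_mx N).
  by rewrite {1}/rdot mul0mx mxE mul0r.
have a_neq0 : rdot u u != 0 by rewrite rdot_eq0.
pose c := (rdot u u)^-1 *: (N *m u^T).
pose N' := N - c *m u.
have uuE : u *m u^T = (rdot u u)%:M by rewrite [LHS]mx11_scalar.
have N'u : N' *m u^T = 0.
  rewrite mulmxBl -mulmxA uuE /c mul_mx_scalar scalerA divff // scale1r.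
  by rewrite subrr.
have NE : N = N' + c *m u by rewrite subrK.
clearbody c N'.
rewrite (gram_col_mx NE N'u) ler_wpM2l ?rdot_ge0 //.
apply: le_trans (IHp N') _; apply: ler_prod => i _.
rewrite rdot_ge0 /=.
have rowN : row i N = row i N' + c i 0 *: u.
  by apply/rowP => j; rewrite [in LHS]NE !mxE big_ord1.
have uN' : rdot (row i N') u = 0.
  by rewrite /rdot -row_mul N'u !mxE.
rewrite rowN !rdotDl !rdotDr !rdotZl !rdotZr (rdotC u) uN' !mulr0 addr0 add0r.
by rewrite lerDl mulrA -expr2 mulr_ge0 ?sqr_ge0 ?rdot_ge0.
Qed.
End RowDot.

(** * Minkowski's theorem on linear forms with integer coefficients *)

Lemma det_diag_seq n (d : seq int) :
  \det (\matrix_(i < n, j < n) (d`_i *+ (i == j :> nat))) = \prod_(i < n) d`_i.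
Proof.
rewrite -(_ : diag_mx (\row_(i < n) d`_i) = \matrix_(i, j) _).
  by rewrite det_diag; apply: eq_bigr => i _; rewrite mxE.
by apply/matrixP => i j; rewrite !mxE.
Qed.

Lemma absz_unit (u : int) : u \is a GRing.unit -> `|u|%N = 1%N.
Proof. by move=> /orP[/eqP->|/eqP->]. Qed.

(* Pigeonhole: the quotient Z^n / P Z^n has |det P| elements, so if s^n > |det P|
   then two points of {0, ..., s-1}^n differ by a vector of P Z^n. *)
Lemma minkowski_int n (P : 'M[int]_n) (s : nat) : (0 < s)%N ->
  (forall z : 'cV[int]_n, z != 0 -> exists i, (s <= `|(P *m z)%R i ord0|)%N) ->
  (s ^ n <= `|\det P|)%N.
Proof.
move=> s_gt0 minP.
have [L uL [U uU [d _ PE]]] := int_Smith_normal_form P.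
set D := \matrix_(i, j) _ in PE.
have detP : (`|\det P| = \prod_(i < n) `|(d`_i)%R|)%N.
  rewrite PE !det_mulmx det_diag_seq !abszM absz_unit -?unitmxE //.
  rewrite [X in (_ * X)%N]absz_unit -?unitmxE // mul1n muln1.
  by rewrite (big_morph absz abszM (erefl _)).
(* A vanishing invariant factor would give a nonzero integer vector killed by [P], against [minP]
   because [s] is positive. *)
have d_neq0 (i : 'I_n) : d`_i != 0.
  apply/negP => /eqP di0.
  have /det0P[v v_neq0 vP] : \det P^T == 0.
    rewrite det_tr -absz_eq0 detP (bigD1 i) //= di0 absz0 mul0n //.
  have vT : v^T != 0 by rewrite -trmx0 (inj_eq trmx_inj).
  have [j] := minP _ vT.
  have -> : P *m v^T = 0 by rewrite -[LHS]trmxK trmx_mul trmxK vP trmx0.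
  by rewrite mxE absz0 leqNgt s_gt0.
have d_gt0 (i : 'I_n) : (0 < `|(d`_i)%R|)%N by rewrite absz_gt0.
pose V (x : {ffun 'I_n -> 'I_s}) : 'cV[int]_n := \col_i (x i)%:Z.
(* Since [P] is [L *m D *m U] with [L] and [U] unimodular, the class of a vector modulo the image of
   [P] is given by the residues of its image under [invmx L] modulo the diagonal entries of [D].
   These moduli vary with [i], hence the dependent functions below. *)
pose r x i := (invmx L *m V x) i ord0.
have r_lt x i : (`|(r x i %% d`_i)%Z| < `|(d`_i)%R|)%N.
  by rewrite -ltz_nat gez0_abs ?modz_ge0 // ltz_mod.
pose f (x : {ffun 'I_n -> 'I_s}) : {dffun forall i : 'I_n, 'I_(`|(d`_i)%R|)} :=
  [ffun i => Ordinal (r_lt x i)].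
suff /leq_card : injective f.
  rewrite card_ffun !card_ord card_dep_ffun detP => /leq_trans; apply.
  rewrite foldrE big_image /=.
  by apply: eq_leq; apply: eq_bigr => i _; rewrite card_ord.
move=> x y fxy; apply/eqP; apply: contraT => xy.
have /fin_all_exists[w wE] (i : 'I_n) : exists w, r x i - r y i = w * d`_i.
  apply/dvdzP; rewrite -eqz_mod_dvd.
  have /(congr1 (fun g : {dffun forall i : 'I_n, 'I_(`|(d`_i)%R|)} => val (g i))) := fxy.
  rewrite !ffunE /= => e; apply/eqP.
  by rewrite -[LHS]gez0_abs ?modz_ge0 // e gez0_abs ?modz_ge0.
pose W : 'cV[int]_n := \col_i w i.
have VE : V x - V y = P *m (invmx U *m W).
  rewrite PE -!mulmxA (mulKVmx uU).
  have <- : invmx L *m (V x - V y) = D *m W.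
    apply/colP => i; transitivity (r x i - r y i).
      by rewrite mulmxBr mxE [X in _ + X]mxE.
    rewrite wE [RHS]mxE.
    rewrite (bigD1 i) //= big1 => [|j ij]; rewrite !mxE.
      by rewrite eqxx mulr1n addr0 mulrC.
    by case: eqP => [/val_inj e|_]; [rewrite e eqxx in ij | rewrite mul0r].
  by rewrite mulKVmx.
have z_neq0 : invmx U *m W != 0.
  apply: contra xy => /eqP W0; move: VE; rewrite W0 mulmx0 => /eqP.
  rewrite subr_eq0 => /eqP VE; apply/eqP/ffunP => i; apply: val_inj.
  by have /colP/(_ i) := VE; rewrite !mxE => -[].
have [i] := minP _ z_neq0; rewrite -VE !mxE leqNgt => /negP[].
have := ltn_ord (x i); have := ltn_ord (y i); move: (val (x i)) (val (y i)).
move=> a b. lia.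
Qed.

(** * Minkowski's theorem on linear forms with real coefficients *)

Section RealForms.
Context {R : realType}.

Lemma cvg_det n (M : nat -> 'M[R]_n) (F : 'M[R]_n) :
  (forall i j, M k i j @[k --> \oo] --> F i j) ->
  \det (M k) @[k --> \oo] --> \det F.
Proof.
move=> MF; rewrite /determinant.
apply: (cvg_big add_continuous) => s _; apply: cvgM; first exact: cvg_cst.
by apply: (cvg_big mul_continuous) => i _; exact: MF.
Qed.

Lemma mulmx_inf_bound n p (M : 'M[R]_(p, n)) (x : 'cV[R]_n) t i :
  (forall j, `|x j 0| <= t) -> `|(M *m x) i 0| <= (\sum_j `|M i j|) * t.
Proof.
move=> xt; rewrite mxE mulr_suml; apply: le_trans (ler_norm_sum _ _ _) _.
by apply: ler_sum => j _; rewrite normrM ler_wpM2l.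
Qed.

(* Rounding k F down to an integer matrix perturbs the values of the linear forms
   at an integer point z by O(|z|) = O(|F z|), i.e. by a bounded factor, so that
   the integer case applies with s = k - O(1); then k tends to infinity. *)
Lemma minkowski_forms n (F : 'M[R]_n) : F \in unitmx ->
  (forall z : 'cV[int]_n, z != 0 ->
     exists i, 1 <= `|(F *m map_mx intr z) i 0|) ->
  1 <= `|\det F|.
Proof.
move=> uF minF.
(* If all values of the forms at [z] are at most [t], the entries of [z] are at most [S * t].
   Changing each coefficient by at most 1 therefore moves these values by at most [n%:R * S * t],
   which is less than [K%:R * t] when [t] is positive. *)
pose S := \sum_j \sum_i `|invmx F j i|.
have S_ge0 : 0 <= S by do 2 (apply: sumr_ge0 => ? _).
pose K := Num.bound (n%:R * S).
have ltK : n%:R * S < K%:R by rewrite archi_boundP // mulr_ge0.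
pose P k : 'M[int]_n := map_mx (fun x => Num.floor (k%:R * x)) F.
have detP k : (K < k)%N -> ((k - K) ^ n <= `|\det (P k)|)%N.
  move=> Kk; apply: minkowski_int; first by rewrite subn_gt0.
  move=> z z_neq0; have [i1 Fi1] := minF _ z_neq0.
  pose w : 'cV[R]_n := F *m map_mx intr z.
  (* The rounding error is controlled by the largest value [t] of the forms, so the form attaining
     [t] is the one sure to stay at least [k - K] after scaling and rounding. *)
  pose i0 := [arg max_(i > i1) `|w i 0|]%O.
  have wi0 i : `|w i 0| <= `|w i0 0|.
    by rewrite /i0; case: arg_maxP => // j _ ; apply.
  set t := `|w i0 0| in wi0; have t_ge1 : 1 <= t by apply: le_trans (wi0 i1).
  have t_ge0 : 0 <= t by apply: le_trans t_ge1.
  have zE : map_mx intr z = invmx F *m w by rewrite mulKmx.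
  have zj j : `|(map_mx intr z : 'cV[R]_n) j 0| <= S * t.
    rewrite zE; apply: le_trans (mulmx_inf_bound _ _ wi0) _.
    rewrite ler_wpM2r // /S [leRHS](bigD1 j) //= lerDl.
    by apply: sumr_ge0 => ? _; apply: sumr_ge0.
  exists i0; rewrite -(ler_nat R) natrB; last exact: ltnW.
  pose E : 'M[R]_n := k%:R *: F - map_mx intr (P k).
  have Ez : `|(E *m map_mx intr z) i0 0| <= n%:R * S * t.
    apply: le_trans (mulmx_inf_bound _ _ zj) _.
    rewrite mulrA ler_wpM2r // ler_wpM2r //.
    rewrite -[X in X%:R]card_ord -sumr_const; apply: ler_sum => j _.
    rewrite !mxE ger0_norm ?subr_ge0 ?floor_le // lerBlDl.
    by have := floorD1_gt (k%:R * F i0 j); rewrite intrD => /ltW.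
  have -> : (`|(P k *m z) i0 ord0|%N)%:R =
      `|(map_mx intr (P k) *m map_mx intr z) i0 0| :> R.
    by rewrite -map_mxM [in RHS]mxE -intr_norm -abszE.
  have -> : map_mx intr (P k) = k%:R *: F - E by rewrite opprB addrC subrK.
  have -> : ((k%:R *: F - E) *m map_mx intr z) i0 0 =
      k%:R * w i0 0 - (E *m map_mx intr z) i0 0.
    by rewrite mulmxBl -scalemxAl !mxE.
  have -> : k%:R - K%:R = (k%:R - K%:R) * 1 :> R by rewrite mulr1.
  apply: le_trans (lerB_dist _ _); rewrite normrM normr_nat.
  rewrite -/t lerBrDr.
  have kK : K%:R <= k%:R :> R by rewrite ler_nat ltnW.
  apply: le_trans (_ : (k%:R - K%:R) * t + n%:R * S * t <= _).
    by rewrite lerD // ler_wpM2l // subr_ge0.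
  by rewrite -mulrDl ler_wpM2r // -lerBrDl opprB addrCA subrr addr0 ltW.
(* The rescaled roundings converge to [F] entrywise. Dividing [detP] at [k.+1] by the [n]-th power
   of [k.+1] bounds their determinants below by a sequence with limit 1. *)
pose M k : 'M[R]_n := k.+1%:R^-1 *: map_mx intr (P k.+1).
have cvgM1 : `|\det (M k)| @[k --> \oo] --> `|\det F|.
  apply: cvg_norm; apply: cvg_det => i j.
  apply: (@squeeze_cvgr _ _ _ _ (fun k => F i j - harmonic k) (fun=> F i j)).
  - near=> k; rewrite !mxE /harmonic /=.
    have k_gt0 : 0 < k.+1%:R :> R by [].
    rewrite mulrC ler_pdivrMr // ler_pdivlMr // mulrBl mulVf ?gt_eqF // !(mulrC (F i j)).
    rewrite floor_le andbT lerBlDr.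
    by have := floorD1_gt (k.+1%:R * F i j); rewrite intrD => /ltW.
  - rewrite -[X in _ --> X]subr0; apply: cvgB; [exact: cvg_cst|exact: cvg_harmonic].
  - exact: cvg_cst.
have cvgK0 : 1 - K%:R * harmonic k @[k --> \oo] --> (1 : R).
  rewrite -[X in _ --> X]subr0; apply: cvgB; first exact: cvg_cst.
  rewrite -[X in _ --> X](mulr0 K%:R); apply: cvgM; first exact: cvg_cst.
  exact: cvg_harmonic.
have cvgK : (1 - K%:R * harmonic k) ^+ n @[k --> \oo] --> (1 : R).
  rewrite -[X in _ --> X](expr1n R n).
  exact: (cvg_comp _ (fun x : R => x ^+ n) cvgK0 (@exprn_continuous R n 1)).
apply: (ler_cvg_to cvgK cvgM1); near=> k.
have Kk : (K < k.+1)%N by rewrite ltnS; near: k; exact: nbhs_infty_ge.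
have := detP _ Kk; rewrite -(ler_nat R) natrX natrB 1?ltnW // => h.
rewrite /M detZ normrM normrX -[k.+1%:R^-1]/(harmonic k) (ger0_norm (harmonic_ge0 k)).
rewrite det_map_mx -intr_norm -abszE.
have -> : 1 - K%:R * harmonic k = harmonic k * (k.+1%:R - K%:R) :> R.
  by rewrite mulrBr /harmonic /= mulVf // [K%:R * _]mulrC.
by rewrite exprMn ler_wpM2l ?exprn_ge0 // harmonic_ge0.
Unshelve. all: by end_near.
Qed.

End RealForms.

(** * Successive minima and Siegel's lemma *)

Section Siegel.
Context {R : realType}.
Implicit Types n m p q : nat.
Notation toR := (map_mx (intr : int -> R)).

(** Minkowski gives 1 as a lower bound for the squared determinant, which is the Gram determinant
    bounded by Hadamard. The number of rows [q] is kept apart from [n] because the system used later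
    is a [col_mx] whose height equals [n] only propositionally. *)
Lemma minkowski_hadamard q n (F : 'M[R]_(q, n)) : q = n ->
  (forall x : 'cV[R]_n, F *m x = 0 -> x = 0) ->
  (forall z : 'cV[int]_n, z != 0 ->
     exists i, 1 <= `|(F *m map_mx intr z) i 0|) ->
  1 <= \prod_i rdot (row i F) (row i F).
Proof.
move=> qn; subst q => injF minF.
have uF : F \in unitmx.
  rewrite unitmxE unitfE -det_tr; apply/det0P => -[v v_neq0 vF].
  move/negP: v_neq0; apply; rewrite -(inj_eq trmx_inj) trmx0; apply/eqP.
  by apply: injF; rewrite -[LHS]trmxK trmx_mul trmxK vF trmx0.
apply: le_trans (hadamard_gram F).
rewrite det_mulmx det_tr -expr2 -real_normK ?num_real //.
by rewrite exprn_ege1 // minkowski_forms.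
Qed.

(** For orthonormal rows, [E^T *m E] is the orthogonal projection onto the row space of [E]. *)
Lemma orthonormal_proj q n (E : 'M[R]_(q, n)) (w : 'rV[R]_n) :
  E *m E^T = 1%:M -> (w <= E)%MS -> w *m E^T *m E = w.
Proof.
by move=> EE /submxP[D ->]; rewrite -!mulmxA (mulmxA E) EE mul1mx.
Qed.

Lemma parseval q n (E : 'M[R]_(q, n)) (w : 'rV[R]_n) :
  E *m E^T = 1%:M -> (w <= E)%MS ->
  rdot w w = \sum_j rdot w (row j E) ^+ 2.
Proof.
move=> EE wE; rewrite {1}/rdot -{1}(orthonormal_proj EE wE) -(mulmxA _ E).
rewrite mxE; apply: eq_bigr => j _.
have -> : (w *m E^T) 0 j = rdot w (row j E).
  by rewrite rdotE mxE; apply: eq_bigr => k _; rewrite !mxE.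
rewrite expr2; congr (_ * _); rewrite rdotC.
by rewrite /rdot -row_mul [RHS]mxE.
Qed.

Lemma row_free_row_neq0 (F : fieldType) q n (Z : 'M[F]_(q, n)) j :
  row_free Z -> row j Z != 0.
Proof.
move=> fZ; rewrite rowE; apply/negP => /eqP.
rewrite -(mul0mx _ Z) => /(row_free_inj fZ) /rowP/(_ j)/eqP.
by rewrite !mxE !eqxx oner_eq0.
Qed.

Lemma map_intr_eq0 p n (M : 'M[int]_(p, n)) : (toR M == 0) = (M == 0).
Proof.
apply/eqP/eqP => [/matrixP M0|->]; last exact: map_mx0.
apply/matrixP => i j; have /eqP := M0 i j.
by rewrite !mxE intr_eq0 => /eqP.
Qed.

(** As a natural number, the squared length of an integer vector is at least 1 once nonzero, and
    shortest vectors exist by well-ordering. *)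
Lemma rdot_int n (z : 'rV[int]_n) :
  rdot (toR z) (toR z) = (`|(\sum_j z 0 j ^+ 2)%R|%N)%:R.
Proof.
rewrite natr_absz ger0_norm; last by apply: sumr_ge0 => j _; rewrite sqr_ge0.
rewrite rdotE rmorph_sum; apply: eq_bigr => j _.
by rewrite !mxE -expr2 rmorphXn.
Qed.

Lemma rdot_int_ge1 n (z : 'rV[int]_n) : z != 0 -> 1 <= rdot (toR z) (toR z).
Proof.
move=> z_neq0; have : 0 < rdot (toR z) (toR z).
  by rewrite rdot_gt0 map_intr_eq0.
by rewrite rdot_int ltr0n ler1n.
Qed.

Lemma minimal_int_vector n (P : 'rV[int]_n -> Prop) :
  (exists z, P z) -> exists2 z, P z &
  forall w, P w -> rdot (toR z) (toR z) <= rdot (toR w) (toR w).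
Proof.
pose N (z : 'rV[int]_n) := `|(\sum_j z 0 j ^+ 2)%R|%N.
move=> [z0 Pz0].
have exN : exists m, `[< exists2 z, P z & N z = m >].
  by exists (N z0); apply/asboolP; exists z0.
case: (ex_minnP exN) => m /asboolP[z Pz Nz] minm.
exists z => // w Pw; rewrite !rdot_int ler_nat -/(N z) Nz; apply: minm.
by apply/asboolP; exists w.
Qed.

(* Successive minima z_0, z_1, ... of the integer points of the space K, together
   with their Gram-Schmidt basis E.  Compressing the j-th axis of E by |z_j| keeps
   all nonzero integer points of K outside the open unit ball: this is how the
   second theorem of Minkowski is reduced to the first for ellipsoids. *)
Lemma successive_minima p n (K : 'M[R]_(p, n)) (i : nat) :
  (forall W : 'M[R]_n, (forall z, (toR z <= K)%MS -> (toR (z : 'rV_n) <= W)%MS) ->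
     (K <= W)%MS) ->
  (i <= \rank K)%N ->
  exists (Z : 'M[int]_(i, n)) (E : 'M[R]_(i, n)),
    let nu j := rdot (row j (toR Z)) (row j (toR Z)) in
    [/\ (toR Z <= K)%MS, (E :=: toR Z)%MS /\ E *m E^T = 1%:M,
        forall z : 'rV[int]_n, (toR z <= K)%MS -> ~~ (toR z <= toR Z)%MS ->
          forall j, nu j <= rdot (toR z) (toR z)
      & forall z : 'rV[int]_n, z != 0 -> (toR z <= toR Z)%MS ->
          1 <= \sum_j rdot (toR z) (row j E) ^+ 2 / nu j].
Proof.
move=> intK; elim: i => [_|i IHi iK].
  exists 0, 0; split.
  - by rewrite map_mx0 sub0mx.
  - split; last by rewrite [LHS]flatmx0 [RHS]flatmx0.
    by rewrite map_mx0; apply/eqmxP; rewrite submx_refl.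
  - by move=> ? ? ? [].
  - move=> z z_neq0; rewrite map_mx0 => /submxP[D /eqP].
    by rewrite mulmx0 map_intr_eq0 (negPf z_neq0).
have [Z [E /= [ZK [EZ EE] minZ ZE]]] := IHi (ltnW iK).
(* The integer points of [K] span it, so they cannot all lie in the row space of [Z], whose
   dimension is at most [i] and hence less than the rank of [K]. *)
have [z0 [z0K z0Z]] : exists z, (toR z <= K)%MS /\ ~~ (toR (z : 'rV_n) <= toR Z)%MS.
  apply: contrapT => h; move: iK; apply/negP; rewrite -leqNgt.
  apply: leq_trans (rank_leq_row (toR Z)); apply: mxrankS.
  have /intK : forall z, (toR z <= K)%MS -> (toR (z : 'rV_n) <= <<toR Z>>)%MS.
    move=> z zK; rewrite genmxE; apply: contrapT => /negP zZ.
    by apply: h; exists z.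
  by rewrite genmxE.
have [z [zK zZ] minz] := @minimal_int_vector n (fun z => (toR z <= K)%MS /\
  ~~ (toR z <= toR Z)%MS) (ex_intro _ z0 (conj z0K z0Z)).
(* The next Gram-Schmidt vector: the component of [z] orthogonal to the earlier axes, normalised to
   [e] below. *)
pose y := toR z - toR z *m E^T *m E.
have yE : y *m E^T = 0 by rewrite mulmxBl -(mulmxA _ E) EE mulmx1 subrr.
have y_neq0 : y != 0.
  apply: contra zZ; rewrite subr_eq0 => /eqP ->.
  by rewrite -EZ submxMl.
have yy_gt0 : 0 < rdot y y by rewrite rdot_gt0.
pose a := Num.sqrt (rdot y y); have a_gt0 : 0 < a by rewrite sqrtr_gt0.
pose e := a^-1 *: y.
have ee : e *m e^T = 1%:M.
  rewrite [LHS]mx11_scalar -[X in X%:M]/(rdot e e) rdotZl rdotZr.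
  by rewrite -(sqr_sqrtr (ltW yy_gt0)) mulrA -invfM -expr2 mulVf ?gt_eqF ?exprn_gt0.
have eE : e *m E^T = 0 by rewrite -scalemxAl yE scaler0.
rewrite -(addn1 i).
pose Z' := col_mx Z z; pose E' := col_mx E e.
have rZ' : toR Z' = col_mx (toR Z) (toR z) by rewrite map_col_mx.
have EZ' : (E' :=: toR Z')%MS.
  apply/eqmxP; rewrite rZ' !col_mx_sub; apply/andP; split; apply/andP; split.
  - by rewrite EZ -addsmxE addsmxSl.
  - rewrite scalemx_sub // addmx_sub -?addsmxE ?addsmxSr // eqmx_opp.
    by rewrite (submx_trans (submxMl _ _)) // EZ addsmxSl.
  - by rewrite -EZ -addsmxE addsmxSl.
  - have -> : toR z = a *: e + toR z *m E^T *m E.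
      by rewrite scalerA divff ?gt_eqF // scale1r subrK.
    rewrite -addsmxE addrC; apply: addmx_sub_adds; first exact: submxMl.
    exact: scalemx_sub (submx_refl e).
have EE' : E' *m E'^T = 1%:M.
  rewrite tr_col_mx mul_col_row EE ee eE -[E *m e^T]trmxK trmx_mul trmxK eE.
  by rewrite trmx0 -scalar_mx_block.
have rowZu j : row (lshift 1 j) (toR Z') = row j (toR Z) by rewrite rZ' rowKu.
have rowZd : row (rshift i 0) (toR Z') = toR z by rewrite rZ' rowKd row_id.
have rowEu j : row (lshift 1 j) E' = row j E by rewrite rowKu.
exists Z', E'; split=> //.
- by rewrite rZ' col_mx_sub ZK.
- move=> w wK wZ' j.
  have wZ : ~~ (toR w <= toR Z)%MS.
    by apply: contra wZ' => /submx_trans; apply; rewrite rZ' -addsmxE addsmxSl.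
  case: (split_ordP j) => {}j ->; first by rewrite rowZu minZ.
  by rewrite ord1 rowZd minz.
move=> w w_neq0 wZ'.
have free_Z' : row_free (toR Z').
  rewrite /row_free -EZ'; apply/row_freeP; exists E'^T; exact: EE'.
have nu_gt0 j : 0 < rdot (row j (toR Z')) (row j (toR Z')).
  by rewrite rdot_gt0 row_free_row_neq0.
have [wZ|wZ] := boolP (toR w <= toR Z)%MS.
  rewrite big_split_ord /= big_ord1; apply: le_trans (ZE w w_neq0 wZ) _.
  under eq_bigr do rewrite -rowEu -rowZu.
  by rewrite lerDl divr_ge0 ?sqr_ge0 ?rdot_ge0.
have wK : (toR w <= K)%MS.
  by apply: submx_trans wZ' _; rewrite rZ' col_mx_sub ZK.
have zz_gt0 : 0 < rdot (toR z) (toR z) by rewrite -rowZd.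
(* Outside the span of [Z], minimality of [z] makes [w] at least as long as [z]. Moreover [z] is the
   longest of the minima by [minZ], so by Parseval the sum only decreases when every denominator is
   replaced by the squared length of [z]. *)
apply: le_trans (_ : rdot (toR w) (toR w) / rdot (toR z) (toR z) <= _).
  by rewrite ler_pdivlMr // mul1r minz.
rewrite (parseval EE'); last by rewrite EZ'.
rewrite mulr_suml; apply: ler_sum => j _.
rewrite ler_wpM2l ?sqr_ge0 // lef_pV2 ?posrE //.
case: (split_ordP j) => {}j ->; first by rewrite rowZu minZ.
by rewrite ord1 rowZd.
Qed.

Lemma rat_row_clear_denoms n (v : 'rV[rat]_n) :
  exists (d : int) (z : 'rV[int]_n), d != 0 /\ d%:~R *: v = map_mx intr z.
Proof.
pose d : int := \prod_j denq (v 0 j).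
exists d, (\row_j (numq (v 0 j) * \prod_(k | k != j) denq (v 0 k))).
split; first by apply/prodf_neq0 => j _; rewrite denq_neq0.
apply/rowP => j; rewrite !mxE /d (bigD1 j) //= !intrM.
rewrite mulrAC -[X in _ * X * _]divq_num_den; field.
by rewrite intr_eq0 denq_neq0.
Qed.

(** The kernel of an integer matrix can be computed over the rationals, so rational vectors span it,
    and clearing denominators makes them integral. This is the spanning hypothesis of
    [successive_minima]. *)
Lemma ker_int_span p n (B : 'M[int]_(p, n)) (W : 'M[R]_n) :
  (forall z : 'rV[int]_n, (toR z <= kermx (toR B)^T)%MS -> (toR z <= W)%MS) ->
  (kermx (toR B)^T <= W)%MS.
Proof.
move=> intW.
have toRE q (M : 'M[int]_(q, n)) :
    map_mx (ratr : rat -> R) (map_mx intr M) = toR M.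
  by apply/matrixP => i j; rewrite !mxE ratr_int.
have kE : kermx (toR B)^T = map_mx ratr (kermx (map_mx intr B : 'M[rat]_(p, n))^T).
  by rewrite map_kermx -map_trmx toRE.
apply/row_subP => i; rewrite kE -map_row.
set v := row i _; have [d [z [d_neq0 dv]]] := rat_row_clear_denoms v.
have dR : d%:~R != 0 :> R by rewrite intr_eq0.
have zE : toR z = d%:~R *: map_mx ratr v.
  by rewrite -toRE -dv map_mxZ /= ratr_int.
rewrite -(eqmx_scale _ dR) -zE; apply: intW.
by rewrite zE kE scalemx_sub // map_submx row_sub.
Qed.

Lemma sub_kermx_col p n (M : 'M[R]_(p, n)) (x : 'cV[R]_n) :
  (x^T <= kermx M^T)%MS = (M *m x == 0).
Proof. by rewrite sub_kermx -trmx_mul -trmx0 (inj_eq trmx_inj). Qed.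

(* Bombieri-Vaaler form of Siegel's lemma, Euclidean version.  The forms given by
   a maximal independent set of rows of B take integer values, and together with
   the compressed axes of the successive minima of the kernel they satisfy the
   hypothesis of Minkowski's theorem on linear forms. *)
Lemma siegel p n (B : 'M[int]_(p, n)) (r l : nat) (beta : R) :
  \rank (toR B) = r -> (r + l)%N = n ->
  (forall i j, `|(B i j)%:~R| <= beta) ->
  exists Z : 'M[int]_(l, n),
    [/\ row_free (toR Z), B *m Z^T = 0
      & \prod_j rdot (row j (toR Z)) (row j (toR Z)) <=
          (n%:R * beta ^+ 2) ^+ r * l%:R ^+ l].
Proof.
move=> rB rl Bbeta.
pose K := kermx (toR B)^T.
have rK : \rank K = l by rewrite mxrank_ker mxrank_tr rB -rl addKn.
have [Z [E [ZK [EZ EE] _ ZE]]] :=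
  successive_minima (@ker_int_span _ _ B) (eq_leq (esym rK)).
have free_Z : row_free (toR Z).
  by rewrite /row_free -EZ; apply/row_freeP; exists E^T.
have KZ : (K <= toR Z)%MS.
  by rewrite -(mxrank_leqif_sup ZK).2 (eqnP free_Z) rK.
exists Z; split => //.
  apply/eqP; rewrite -map_intr_eq0 map_mxM -map_trmx -trmx_eq0 trmx_mul trmxK.
  by move: ZK; rewrite sub_kermx.
pose nu j := rdot (row j (toR Z)) (row j (toR Z)).
have nu_gt0 j : 0 < nu j by rewrite rdot_gt0 row_free_row_neq0.
pose f := maxrankfun (toR B).
pose B0 : 'M[int]_(\rank (toR B), n) := rowsub f B.
have B0E : (toR B0 :=: toR B)%MS.
  have -> : toR B0 = rowsub f (toR B) by apply/matrixP => i j; rewrite !mxE.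
  exact: eq_maxrowsub.
have ker_B0 (x : 'cV[R]_n) : toR B0 *m x = 0 -> (x^T <= K)%MS.
  move=> B0x; rewrite sub_kermx_col.
  have /submxP[D ->] : (toR B <= toR B0)%MS by rewrite B0E.
  by rewrite -mulmxA B0x mulmx0.
(* By [ZE], the [l] terms attached to a nonzero integer point of the kernel sum to at least 1, so
   one of them is at least [l%:R^-1]. The factor [l%:R / nu j] under the root turns this into a
   value at least 1 of the corresponding form. *)
pose C : 'M[R]_(l, n) := \matrix_j (Num.sqrt (l%:R / nu j) *: row j E).
have CE i (x : 'cV[R]_n) :
    (C *m x) i 0 = Num.sqrt (l%:R / nu i) * rdot x^T (row i E).
  have -> : (C *m x) i 0 = (row i C *m x) 0 0 by rewrite -row_mul [RHS]mxE.
  by rewrite rowK -scalemxAl mxE rdotC /rdot trmxK.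
have l_gt0 (j : 'I_l) : 0 < l%:R :> R.
  by rewrite ltr0n; apply: leq_ltn_trans (ltn_ord j).
have lnu_gt0 j : 0 < l%:R / nu j by rewrite divr_gt0 ?l_gt0.
pose F := col_mx (toR B0) C.
have : 1 <= \prod_i rdot (row i F) (row i F).
  apply: minkowski_hadamard; first by rewrite rB.
  - move=> x; rewrite mul_col_mx -[RHS]col_mx0 => /eq_col_mx[B0x /colP Cx].
    have xE : (x^T <= E)%MS by rewrite EZ (submx_trans (ker_B0 x B0x)).
    apply/eqP; rewrite -trmx_eq0 -rdot_eq0 (parseval EE xE).
    rewrite big1 // => j _; have /eqP := Cx j.
    by rewrite CE mxE mulf_eq0 gt_eqF ?sqrtr_gt0 //= => /eqP ->; rewrite expr0n.
  - move=> z z_neq0; have [B0z|] := eqVneq (toR B0 *m toR z) 0; last first.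
      rewrite -map_mxM map_intr_eq0 => /matrix0Pn[i [j B0z]].
      exists (lshift l i); rewrite mul_col_mx col_mxEu -map_mxM mxE -intr_norm.
      by rewrite (ler_int R 1) -gtz0_ge1 normr_gt0 -(ord1 j).
    have zZ : (toR z^T <= toR Z)%MS.
      by rewrite -map_trmx (submx_trans (ker_B0 _ B0z)).
    have zT_neq0 : z^T != 0 by rewrite trmx_eq0.
    apply: contrapT => Fz; have := ZE _ zT_neq0 zZ; apply/negP; rewrite -ltNge.
    have lt1 j : rdot (toR z^T) (row j E) ^+ 2 / nu j < l%:R^-1.
      rewrite -(ltr_pM2l (l_gt0 j)) divff ?gt_eqF ?l_gt0 // mulrCA mulrC.
      have : `|(F *m toR z) (rshift _ j) 0| < 1.
        by rewrite ltNge; apply/negP => h; apply: Fz; exists (rshift _ j).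
      rewrite mul_col_mx col_mxEd CE normrM ger0_norm ?sqrtr_ge0 // map_trmx => h.
      have : (Num.sqrt (l%:R / nu j) * `|rdot (toR z^T) (row j E)|) ^+ 2 < 1.
        by rewrite expr_lt1 // mulr_ge0 ?sqrtr_ge0.
      by rewrite exprMn sqr_sqrtr ?(ltW (lnu_gt0 j)) // real_normK ?num_real.
    (* The strict comparison of sums needs a nonempty index set; for [l] equal to 0 the sum is
       simply 0. *)
    have [l0|l_neq0] := eqVneq l 0%N.
      by rewrite big1 // => j _; have := ltn_ord j; rewrite [X in (_ < X)%N]l0.
    apply: lt_le_trans (_ : \sum_(j < l) l%:R^-1 <= _).
      apply: ltr_sum => //; apply/hasP.
      have l0 : (0 < l)%N by rewrite lt0n.
      by exists (Ordinal l0); rewrite ?mem_index_enum.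
    by rewrite sumr_const card_ord -[l%:R^-1 *+ l]mulr_natl divff // pnatr_eq0.
rewrite big_split_ord /=.
(* The axes are unit vectors, so the rows of [C] have squared lengths [l%:R / nu j]; multiplying
   through by the product of the [nu j] leaves only the rows of [B0] to estimate. *)
have -> : \prod_i rdot (row (rshift (\rank (toR B)) i) F)
                      (row (rshift (\rank (toR B)) i) F) =
    l%:R ^+ l / \prod_j nu j.
  have -> : l%:R ^+ l = \prod_(j < l) l%:R :> R by rewrite prodr_const card_ord.
  rewrite -prodfV -big_split /=.
  apply: eq_bigr => j _; rewrite rowKd rowK rdotZl rdotZr mulrA -expr2.
  rewrite sqr_sqrtr ?(ltW (lnu_gt0 j)) //.
  have -> : rdot (row j E) (row j E) = (E *m E^T) j j.
    by rewrite rdotE mxE; apply: eq_bigr => k _; rewrite !mxE.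
  by rewrite EE mxE eqxx mulr1.
have nu_prod_gt0 : 0 < \prod_j nu j by apply: prodr_gt0.
rewrite mulrA ler_pdivlMr // mul1r => /le_trans; apply.
rewrite ler_wpM2r ?exprn_ge0 // -[X in _ ^+ X]rB.
have -> : (n%:R * beta ^+ 2) ^+ \rank (toR B) =
    \prod_(i < \rank (toR B)) (n%:R * beta ^+ 2).
  by rewrite prodr_const card_ord.
apply: ler_prod => i _; rewrite rdot_ge0 /= rowKu rdotE.
rewrite -[X in X%:R * _]card_ord mulr_natl -sumr_const; apply: ler_sum => j _.
rewrite !mxE -expr2 -real_normK ?num_real // lerXn2r ?nnegrE //.
by apply: le_trans (Bbeta (f i) j).
Qed.

Lemma row_free_usubmx (F : fieldType) q1 q2 n (M : 'M[F]_(q1 + q2, n)) :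
  row_free M -> row_free (usubmx M).
Proof.
move=> fM; rewrite -kermx_eq0; apply/eqP/row_matrixP => i; rewrite row0.
set v := row i _.
have vM : row_mx v 0 *m M = 0 *m M.
  rewrite -[in LHS](vsubmxK M) mul_row_col !mul0mx addr0.
  by apply/eqP; rewrite -sub_kermx row_sub.
by have := row_free_inj fM vM; rewrite -[X in _ = X]row_mx0 => /eq_row_mx[].
Qed.

(** When the rank [r] is smaller than [d], [siegel] supplies [d - r] vectors too many. Dropping them
    does not increase the product, since nonzero integer vectors have length at least 1, and
    [1 <= beta] lets the exponent of [beta] grow from [2 * r] to [2 * d]. *)
Lemma siegel_le p n (B : 'M[int]_(p, n)) (d l : nat) (beta : R) :
  (\rank (toR B) <= d)%N -> (d + l)%N = n -> 1 <= beta ->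
  (forall i j, `|(B i j)%:~R| <= beta) ->
  exists Z : 'M[int]_(l, n),
    [/\ row_free (toR Z), B *m Z^T = 0
      & \prod_j rdot (row j (toR Z)) (row j (toR Z)) <=
          n%:R ^+ n * beta ^+ (2 * d)].
Proof.
move=> rd dl beta1 Bbeta; set r := \rank _ in rd.
have rl : (r + (l + (d - r)))%N = n by lia.
have [Z [fZ BZ prodZ]] := siegel (erefl r) rl Bbeta.
exists (usubmx Z); split.
- by rewrite map_usubmx row_free_usubmx.
- have : Z *m B^T = 0 by rewrite -[LHS]trmxK trmx_mul trmxK BZ trmx0.
  rewrite -[X in X *m _](vsubmxK Z) mul_col_mx -[RHS]col_mx0 => /eq_col_mx[ZB _].
  by rewrite -[LHS]trmxK trmx_mul trmxK ZB trmx0.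
have nu_ge1 j : 1 <= rdot (row j (toR Z)) (row j (toR Z)).
  rewrite -map_row rdot_int_ge1 // -map_intr_eq0 map_row.
  exact: row_free_row_neq0.
apply: le_trans (_ : \prod_j rdot (row j (toR Z)) (row j (toR Z)) <= _).
  rewrite big_split_ord /=.
  under eq_bigr do rewrite map_usubmx row_usubmx.
  apply: ler_peMr; first by apply: prodr_ge0 => j _; exact: rdot_ge0.
  apply: le_trans (_ : \prod_(j < d - r) (1 : R) <= _); first by rewrite big1_eq.
  by apply: ler_prod => j _; rewrite ler01 nu_ge1.
apply: le_trans prodZ _.
have n_ge0 : 0 <= n%:R :> R by [].
have beta_ge0 : 0 <= beta by apply: le_trans beta1.
rewrite exprMn -exprM mulrAC.
have -> : n%:R ^+ n = n%:R ^+ r * n%:R ^+ (l + (d - r)) :> R.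
  by rewrite -exprD rl.
apply: ler_pM; rewrite ?mulr_ge0 ?exprn_ge0 //.
  by rewrite ler_wpM2l ?exprn_ge0 // lerXn2r ?nnegrE // ler_nat; lia.
by rewrite ler_weXn2l // leq_mul2l rd.
Qed.

(** * Norm estimates for matrices, and the defining inequality of [mu] *)

Lemma rdot_cauchy_schwarz n (x y : 'rV[R]_n) :
  rdot x y ^+ 2 <= rdot x x * rdot y y.
Proof.
have [->|y_neq0] := eqVneq y 0.
  by rewrite rdotC /rdot !mul0mx !mxE expr0n /= mulr0.
have yy : 0 < rdot y y by rewrite rdot_gt0.
have := rdot_ge0 (rdot y y *: x - rdot x y *: y).
rewrite -scaleNr !rdotDl !rdotDr !rdotZl !rdotZr (rdotC y x).
set a := rdot x x; set b := rdot x y; set c := rdot y y => h.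
rewrite -subr_ge0 -(pmulr_rge0 _ yy) -/c; move: h; congr (0 <= _); ring.
Qed.

Lemma mx_entry_le_norm p q (M : 'M[R]_(p, q)) i j : `|M i j| <= `|M|.
Proof.
rewrite [leRHS]mx_normrE.
exact: (@le_bigmax _ _ _ 0 (fun ij : 'I_p * 'I_q => `|M ij.1 ij.2|) (i, j)).
Qed.

Lemma mx_norm_le p q (M : 'M[R]_(p, q)) c :
  0 <= c -> (forall i j, `|M i j| <= c) -> `|M| <= c.
Proof.
move=> c_ge0 Mc; rewrite [leLHS]mx_normrE.
by apply: bigmax_le => // -[i j] _; exact: Mc.
Qed.

Lemma mulmx_norm_sqr_le n (A : 'M[R]_n) (z : 'rV[R]_n) :
  `|A *m z^T| ^+ 2 <= n%:R * `|A| ^+ 2 * rdot z z.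
Proof.
set c := leRHS.
have c_ge0 : 0 <= c by rewrite !mulr_ge0 ?exprn_ge0 ?rdot_ge0.
rewrite -(sqr_sqrtr c_ge0) lerXn2r ?nnegrE ?sqrtr_ge0 //.
apply: mx_norm_le; rewrite ?sqrtr_ge0 // => i j.
rewrite -(@ler_pXn2r _ 2) ?nnegrE ?sqrtr_ge0 // sqr_sqrtr // real_normK ?num_real //.
have -> : (A *m z^T) i j = rdot (row i A) z.
  by rewrite ord1 /rdot -row_mul [RHS]mxE.
apply: le_trans (rdot_cauchy_schwarz _ _) _; rewrite ler_wpM2r ?rdot_ge0 //.
have -> : n%:R * `|A| ^+ 2 = \sum_(k < n) `|A| ^+ 2.
  by rewrite sumr_const card_ord mulr_natl.
rewrite rdotE; apply: ler_sum => k _; rewrite mxE -expr2.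
by rewrite -real_normK ?num_real // lerXn2r ?nnegrE // mx_entry_le_norm.
Qed.

(** Provides the upper bound that makes the [sup] in [mu] a genuine supremum. *)
Lemma lfun_bounded n p (f : 'Hom('cV[R]_n, 'cV[R]_p)) :
  exists C : R, forall x, `|f x| <= C * `|x|.
Proof.
exists (\sum_i `|f (delta_mx i 0)|) => x.
have xE : x = \sum_i x i 0 *: delta_mx i 0.
  by rewrite [LHS]matrix_sum_delta; apply: eq_bigr => i _; rewrite big_ord1.
rewrite {1}xE linear_sum; apply: le_trans (ler_norm_sum _ _ _) _.
rewrite mulr_suml; apply: ler_sum => i _.
by rewrite linearZ /= normrZ mulrC ler_wpM2l // mx_entry_le_norm.
Qed.

Lemma Phi_le_mu n m (L : set 'cV[R]_n) (alpha : 'I_m -> R) (x : 'cV[R]_n) :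
  `|Phi L alpha x| <= mu L alpha * `|x|.
Proof.
have [->|x_neq0] := eqVneq x 0; first by rewrite linear0 !normr0 mulr0.
rewrite -ler_pdivrMr ?normr_gt0 //; apply: ub_le_sup; last by exists x.
have [C PhiC] := lfun_bounded (Phi L alpha).
by exists C => _ [y /= y_neq0 <-]; rewrite ler_pdivrMr ?normr_gt0.
Qed.

End Siegel.

(** * Rational dimension and ranks of integer matrices *)

Section RationalRank.
Context {R : realType}.
Implicit Types n m : nat.
Notation toR := (map_mx (intr : int -> R)).
Notation QtoR := (map_mx (ratr : rat -> R)).
Notation ZtoQ := (map_mx (intr : int -> rat)).

Lemma map_ratr_intr p q (M : 'M[int]_(p, q)) : QtoR (ZtoQ M) = toR M.
Proof. by apply/matrixP => i j; rewrite !mxE ratr_int. Qed.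

Lemma rat_spanP n (x : 'rV[R]_n) (v : R) :
  rat_span (x 0) v <-> exists c : 'cV[rat]_n, v = (x *m QtoR c) 0 0.
Proof.
split=> [[c _ <-]|[c ->]].
  exists (\col_i c i); rewrite mxE; apply: eq_bigr => i _.
  by rewrite !mxE mulrC.
exists (fun i => c i 0) => //; rewrite mxE; apply: eq_bigr => i _.
by rewrite !mxE mulrC.
Qed.

Lemma rat_freeP n (x : 'rV[R]_n) :
  rat_free (x 0) <-> forall c : 'cV[rat]_n, x *m QtoR c = 0 -> c = 0.
Proof.
split=> [fx c xc|fx c xc i].
  apply/colP => i; rewrite [RHS]mxE; apply: (fx (fun i => c i 0)).
  have /rowP/(_ 0) := xc; rewrite !mxE => xc0; rewrite -[RHS]xc0.
  by apply: eq_bigr => k _; rewrite !mxE mulrC.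
have /fx/colP/(_ i) : x *m QtoR (\col_i c i) = 0.
  apply/rowP => j; rewrite !mxE -[RHS]xc.
  by apply: eq_bigr => k _; rewrite !mxE mulrC.
by rewrite !mxE.
Qed.

Lemma rat_free_mulmx n p (x : 'rV[R]_n) (M : 'M[rat]_(n, p)) :
  rat_free (x 0) -> x *m QtoR M = 0 -> M = 0.
Proof.
move=> /rat_freeP fx xM; apply/trmx_inj/row_matrixP => j.
rewrite trmx0 row0 -tr_col; apply/eqP; rewrite trmx_eq0; apply/eqP/fx.
by rewrite map_col colE mulmxA xM mul0mx.
Qed.

(** A rational relation becomes an integer one after multiplication by a common denominator. *)
Lemma int_free_rat_free m (alpha : 'I_m -> R) :
  (forall c : 'I_m -> int, \sum_(i < m) alpha i *~ c i = 0 -> forall i, c i = 0) ->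
  rat_free alpha.
Proof.
move=> falpha c c0 i.
have [d [z [d_neq0 dz]]] := rat_row_clear_denoms (\row_i c i).
have zE j : (z 0 j)%:~R = d%:~R * c j by have /rowP/(_ j) := dz; rewrite !mxE.
have zE' j : (z 0 j)%:~R = d%:~R * ratr (c j) :> R.
  by rewrite -[LHS]ratr_int zE rmorphM /= ratr_int.
have /falpha/(_ i) : \sum_(j < m) alpha j *~ z 0 j = 0.
  transitivity (d%:~R * \sum_(j < m) ratr (c j) * alpha j : R).
    by rewrite mulr_sumr; apply: eq_bigr => j _; rewrite -mulrzl zE' -mulrA.
  by rewrite [X in _ * X]c0 mulr0.
move=> zi0; have /eqP := zE i; rewrite zi0 eq_sym mulf_eq0 intr_eq0 (negPf d_neq0).
by move=> /eqP.
Qed.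

(** Let [x] be the product of [a] and [b], and [y] a rational basis of the span of its entries, of
    size [d]. Expressing [y] by [x] and [x] by [y] and cancelling [a] by freeness factors [b]
    through a matrix [C] with [d] rows, so its rank is at most [d]. *)
Lemma rank_le_rational_dim m n (a : 'rV[R]_m) (b : 'M[int]_(m, n)) :
  rat_free (a 0) -> (\rank (toR b) <= rational_dim (a *m toR b))%N.
Proof.
move=> fa; rewrite -map_ratr_intr mxrank_map; set bQ := ZtoQ b.
set x := a *m _.
(* Existence of a finite basis rules out the default value 0 of [rat_dim]. The column base of [bQ]
   gives one: it has a left inverse, so [a] times it stays free. *)
have : exists d, exists y : 'I_d -> R, rat_free y /\ rat_span y = rat_span (x 0).
  exists (\rank bQ); pose y := a *m QtoR (col_base bQ).
  have bE : QtoR bQ = QtoR (col_base bQ) *m QtoR (row_base bQ).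
    by rewrite -map_mxM mulmx_base.
  have /row_fullP[C CE] := col_base_full bQ.
  have /row_freeP[D DE] := row_base_free bQ.
  have bD : bQ *m D = col_base bQ.
    by rewrite -[X in X *m D]mulmx_base -mulmxA DE mulmx1.
  exists (y 0); split.
    apply/rat_freeP => c; rewrite -mulmxA -map_mxM => /(rat_free_mulmx fa) c0.
    by rewrite -[c]mul1mx -CE -mulmxA c0 mulmx0.
  apply/seteqP; split=> v /rat_spanP[c ->]; apply/rat_spanP.
    exists (D *m c); congr (_ _ 0 0); rewrite /x /y -!mulmxA -!map_mxM.
    congr (_ *m map_mx _ _).
    by rewrite mulmxA bD.
  exists (row_base bQ *m c); congr (_ _ 0 0).
  by rewrite /x /y bE (map_mxM _ (row_base bQ)) !mulmxA.
rewrite /rational_dim /rat_dim => /(xgetPex 0%N).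
move: (xget _ _) => d [y0 [fy yx]].
pose y : 'rV[R]_d := \row_i y0 i.
have yE : y 0 = y0 by apply/funext => i; rewrite mxE.
rewrite -yE in fy yx.
have /fin_all_exists[e eE] j : exists c : 'cV[rat]_n, y 0 j = (x *m QtoR c) 0 0.
  apply/rat_spanP; rewrite -yx; apply/rat_spanP; exists (delta_mx j 0).
  by rewrite map_delta_mx -colE [RHS]mxE.
have /fin_all_exists[c cE] j : exists c : 'cV[rat]_d, x 0 j = (y *m QtoR c) 0 0.
  apply/rat_spanP; rewrite yx; apply/rat_spanP; exists (delta_mx j 0).
  by rewrite map_delta_mx -colE [RHS]mxE.
pose E : 'M[rat]_(n, d) := \matrix_(i, j) e j i 0.
pose C : 'M[rat]_(d, n) := \matrix_(i, j) c j i 0.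
have yxE : y = x *m QtoR E.
  by apply/rowP => j; rewrite eE !mxE; apply: eq_bigr => k _; rewrite !mxE.
have xyC : x = y *m QtoR C.
  by apply/rowP => j; rewrite cE !mxE; apply: eq_bigr => k _; rewrite !mxE.
have : a *m QtoR (bQ - bQ *m E *m C) = 0.
  rewrite map_mxB !map_mxM mulmxBr !mulmxA -/x.
  by rewrite -yxE -xyC subrr.
move/(rat_free_mulmx fa)/eqP; rewrite subr_eq0 => /eqP ->.
exact: leq_trans (mxrankM_maxr _ _) (rank_leq_row _).
Qed.

End RationalRank.

(** * Integer coordinates with respect to [alpha] *)

Section Coordinates.
Context {R : realType} (n m : nat) (A : 'M[R]_n) (alpha : 'I_m -> R).
Hypothesis alpha_basis : int_basis (coord_group (lattice_of A)) alpha.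
Notation toR := (map_mx (intr : int -> R)).

Lemma col_in_lattice j : lattice_of A (col j A).
Proof. by exists (delta_mx j 0) => //; rewrite map_delta_mx -colE. Qed.

Lemma entry_int_comb i j : exists c : 'I_m -> int,
  A i j = \sum_t alpha t * (c t)%:~R.
Proof.
have : coord_group (lattice_of A) (A i j).
  apply: sub_gen_smallest; exists (col j A); first exact: col_in_lattice.
  by exists i => //; rewrite mxE.
case: alpha_basis => _ <- [c _ <-]; exists c.
by apply: eq_bigr => t _; rewrite mulrzr.
Qed.

Lemma int_combE (F : 'M[int]_(m, n)) i :
  int_comb alpha F i 0 = \sum_t alpha t * (F t i)%:~R.
Proof. by rewrite /int_comb summxE; apply: eq_bigr => t _; rewrite !mxE. Qed.

Lemma col_int_comb j : exists F : 'M[int]_(m, n), col j A = int_comb alpha F.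
Proof.
have /fin_all_exists[c cE] i := entry_int_comb i j.
exists (\matrix_(t, i) c i t); apply/colP => i; rewrite mxE int_combE cE.
by apply: eq_bigr => t _; rewrite mxE.
Qed.

Lemma int_comb_inj : injective (int_comb (n := n) alpha).
Proof.
move=> F G /colP FG; apply/matrixP => t i; apply/eqP; rewrite -subr_eq0; apply/eqP.
apply: (alpha_basis.1 (fun t => F t i - G t i)).
have := FG i; rewrite !int_combE => /eqP; rewrite -subr_eq0 -sumrB => /eqP FG0.
rewrite -[RHS]FG0.
by apply: eq_bigr => k _; rewrite -mulrBr -intrB mulrzr.
Qed.

Lemma Phi_latticeE (F : 'M[int]_(m, n)) :
  Phi_lattice alpha (int_comb alpha F) = stack_rows F.
Proof.
rewrite /Phi_lattice; congr stack_rows; apply: int_comb_inj.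
by have /xgetPex : exists G : 'M[int]_(m, n), int_comb alpha F = int_comb alpha G
  by exists F.
Qed.

(** A linear extension must be exhibited for the [xget] in [Phi] to be meaningful. The columns of
    [A] form a basis of the space, so sending column [j] to its stacked coordinates defines one; it
    agrees with [Phi_lattice] on the lattice because coordinates are additive and unique. *)
Lemma Phi_on_lattice : A \in unitmx ->
  forall x, lattice_of A x -> Phi (lattice_of A) alpha x = Phi_lattice alpha x.
Proof.
move=> uA; rewrite /Phi; apply: (@xgetPex _ 0 (fun f : 'Hom('cV[R]_n, 'cV[R]_(m * n)) =>
  forall x, lattice_of A x -> f x = Phi_lattice alpha x)).
have /fin_all_exists[F FE] := col_int_comb.
pose S : 'M[R]_(m * n, n) := \matrix_(k, j) stack_rows (F j) k 0.
exists (linfun (mulmx (S *m invmx A))) => x [z _ <-]; rewrite lfunE /=.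
rewrite -mulmxA mulKmx //.
have -> : A *m toR z = int_comb alpha (\sum_j z j 0 *: F j).
  apply/colP => i; rewrite int_combE mxE.
  transitivity (\sum_j \sum_t alpha t * (F j t i)%:~R * (z j 0)%:~R).
    by apply: eq_bigr => j _; rewrite -mulr_suml -int_combE -FE !mxE.
  rewrite exchange_big; apply: eq_bigr => t _; rewrite summxE rmorph_sum mulr_sumr.
  by apply: eq_bigr => j _; rewrite !mxE rmorphM /= -mulrA [(F j t i)%:~R * _]mulrC.
rewrite Phi_latticeE; apply/colP => k; case/mxvec_indexP: k => t i.
rewrite mxE [RHS]mxE mxvecE mxE summxE rmorph_sum.
by apply: eq_bigr => j _; rewrite !mxE mxvecE !mxE rmorphM mulrC.
Qed.

(** The coordinates of the entries in column [j] of [A] are the entries of the image of that column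
    under [Phi], so [Phi_le_mu] bounds them. *)
Lemma bounded_coordinates : A \in unitmx ->
  exists F : 'I_n -> 'M[int]_(m, n),
    (forall i j, A i j = \sum_t alpha t * (F j t i)%:~R) /\
    (forall j t i, `|(F j t i)%:~R| <= mu (lattice_of A) alpha * `|A|).
Proof.
move=> uA.
have /fin_all_exists[F FE] := col_int_comb.
exists F; split=> [i j|j t i]; first by rewrite -int_combE -FE mxE.
have PhiF : Phi (lattice_of A) alpha (col j A) = stack_rows (F j).
  by rewrite Phi_on_lattice ?FE ?Phi_latticeE // -FE; exact: col_in_lattice.
have -> : (F j t i)%:~R = stack_rows (F j) (mxvec_index t i) 0 :> R.
  by rewrite mxE mxvecE mxE.
rewrite -PhiF; apply: le_trans (mx_entry_le_norm _ _ _) _.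
apply: le_trans (Phi_le_mu _ _ _) _.
rewrite ler_wpM2l //; last first.
  by apply: mx_norm_le => // k l; rewrite mxE mx_entry_le_norm.
(* Nonnegativity of [mu] comes from the same inequality at a column of [A], nonzero because [A] is
   invertible. *)
have := Phi_le_mu (lattice_of A) alpha (col j A).
have colA : 0 < `|col j A|.
  rewrite normr_gt0; apply/negP => /eqP colA0.
  move: uA; rewrite unitmxE (expand_det_col _ j) big1 ?unitr0 // => k _.
  by have /colP/(_ k) := colA0; rewrite !mxE => ->; rewrite mul0r.
by move=> /(le_trans (normr_ge0 _)); rewrite pmulr_lge0.
Qed.

End Coordinates.

(** * The integer linear system attached to [I], and the final estimate *)

Lemma rank_rows_le (R : realType) (n m : nat) (A : 'M[R]_n) (alpha : 'I_m -> R)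
    (F : 'I_n -> 'M[int]_(m, n)) (I : {set 'I_n}) :
  rat_free alpha -> (forall i j, A i j = \sum_t alpha t * (F j t i)%:~R) ->
  exists p (B : 'M[int]_(p, n)),
    [/\ (\rank (map_mx intr B : 'M[R]_(p, n)) <= rational_dim_rows A I)%N,
        forall k, exists t i, forall j, B k j = F j t i
      & forall z : 'cV[int]_n, B *m z = 0 ->
        forall i, i \in I -> (A *m map_mx intr z) i 0 = 0].
Proof.
move=> fa AE.
(* One equation for each [i] in [I] and each basis index [t]: coordinate [i] of [A z] is the
   combination of the [alpha t] whose coefficients are the values of these equations at [z]. *)
pose T := {it : 'I_n * 'I_m | it.1 \in I}.
pose B : 'M[int]_(#|{: T}|, n) :=
  \matrix_(k, j) F j (val (enum_val k)).2 (val (enum_val k)).1.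
pose b i : 'M[int]_(m, n) := \matrix_(t, j) F j t i.
exists _, B; split.
(* The rows of [B] come from the blocks [b i] with [i] in [I]. Row [i] of [A] is [alpha] times
   [b i], so the rank of each block is at most the rational dimension of that row. *)
- have BS : (map_mx intr B <= \sum_(i in I) <<map_mx intr (b i) : 'M[R]_(m, n)>>)%MS.
    apply/row_subP => k; case kE: (enum_val k) => [[i t] /= iI].
    apply: (sumsmx_sup i) => //; rewrite genmxE.
    apply: (eq_row_sub t); apply/rowP => j; rewrite !mxE kE //.
  apply: leq_trans (mxrankS BS) _.
  apply: (@leq_trans (\sum_(i in I) \rank (map_mx intr (b i) : 'M[R]_(m, n)))%N).
    apply: (big_ind2 (fun (M : 'M[R]_n) r => \rank M <= r)%N).
    + by rewrite mxrank0.
    + move=> M r N s Mr Ns; apply: leq_trans (mxrank_adds_leqif _ _) _.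
      exact: leq_add.
    + by move=> i _; rewrite genmxE.
  apply: leq_sum => i _.
  have -> : row i A = (\row_t alpha t) *m map_mx intr (b i).
    by apply/rowP => j; rewrite !mxE AE; apply: eq_bigr => t _; rewrite !mxE.
  apply: rank_le_rational_dim.
  by rewrite (_ : _ 0 = alpha) //; apply/funext => t; rewrite mxE.
- by move=> k; eexists; eexists => j; rewrite mxE.
- move=> z Bz i iI; rewrite mxE.
  transitivity (\sum_t alpha t * (\sum_j F j t i * z j 0)%:~R).
    transitivity (\sum_j \sum_t alpha t * (F j t i)%:~R * (z j 0)%:~R).
      by apply: eq_bigr => j _; rewrite -mulr_suml -AE mxE.
    rewrite exchange_big; apply: eq_bigr => t _; rewrite rmorph_sum mulr_sumr.
    by apply: eq_bigr => j _; rewrite rmorphM /= mulrA.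
  rewrite big1 // => t _; pose k : T := Sub (i, t) iI.
  have /colP/(_ (enum_rank k)) := Bz; rewrite !mxE => Bzk.
  rewrite (_ : \sum_j _ = 0) ?mulr0 // -[RHS]Bzk.
  by apply: eq_bigr => j _; rewrite mxE enum_rankK.
Qed.

(** Compares the squares of the two sides of the theorem, with [N] and [q] standing for [n], [a] for
    the norm of [A] and [M] for [mu]: the factor [N * a ^+ 2] is lost once per vector, and the rest
    is the bound of [siegel_le]. *)
Lemma square_bound_eq (F : comPzRingType) (N a M : F) (d l q : nat) :
  (N * a ^+ 2) ^+ l * (N ^+ q * (M * a) ^+ (2 * d)) =
  N ^+ (l + q) * (a ^+ (d + l)) ^+ 2 * (M ^+ d) ^+ 2.
Proof.
rewrite (exprMn _ N) (exprMn _ M) -!exprM mulnDl !(mulnC _ 2%N).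
rewrite (exprD N l q) (exprD a (2 * d)%N (2 * l)%N).
move: (N ^+ l) (N ^+ q) (a ^+ _) (M ^+ _) (a ^+ _) => x y z t u; ring.
Qed.

Theorem theorem1p1 (R : realType) (n : nat) (hn : (2 <= n)%N)
    (A : 'M[R]_n) (hA : A \in unitmx)
    (m : nat) (alpha : 'I_m -> R)
    (halpha : int_basis (coord_group (lattice_of A)) alpha)
    (k : nat) (hk1 : (1 <= k)%N) (hkn : (k < n)%N)
    (I : {set 'I_n}) (hI : #|I| = (n - k)%N)
    (hd : (rational_dim_rows A I < n)%N)
    (l : nat) (hl : l = (n - rational_dim_rows A I)%N) :
  (sparsity_level (lattice_of A) l <= k)%N /\
  exists x : 'I_l -> 'cV[R]_n,
    [/\ forall i, lattice_of A (x i),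
        free [tuple x i | i < l],
        forall i, (norm0 (x i) <= k)%N
      & \prod_(i < l) `|x i| <=
          (n%:R : R) `^ (n%:R - (rational_dim_rows A I)%:R / 2) * `|A| ^+ n
          * mu (lattice_of A) alpha ^+ rational_dim_rows A I].
Proof.
set M := mu _ _; set d := rational_dim_rows A I in hd hl *.
have dl : (d + l)%N = n by rewrite hl subnKC // ltnW.
suff [x [xL xfree xk xprod]] : exists x : 'I_l -> 'cV[R]_n,
    [/\ forall i, lattice_of A (x i), free [tuple x i | i < l],
        forall i, (norm0 (x i) <= k)%N
      & \prod_(i < l) `|x i| <=
          (n%:R : R) `^ (n%:R - d%:R / 2) * `|A| ^+ n * M ^+ d].
  split; last by exists x.
  (* The first goal asks that the default value [n] be admissible, which holds since vectors that
     are [k]-sparse are [n]-sparse. *)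
  rewrite /sparsity_level; case: arg_minnP => [|s _ smin].
    apply/asboolP; exists x; split => // j; apply: leq_trans (xk j) _; exact: ltnW.
  have kn : (k < n.+1)%N by exact: ltnW.
  apply: (smin (Ordinal kn)); apply/asboolP; by exists x.
have [F [AE Fbound]] := bounded_coordinates halpha hA.
have [p [B [rB BF BA]]] := rank_rows_le I (int_free_rat_free halpha.1) AE.
have beta1 : 1 <= M * `|A|.
  have /matrix0Pn[i [j Aij]] : A != 0.
    apply: contra_eq_neq (mulVmx hA) => ->; rewrite mulmx0.
    apply/eqP => /matrixP/(_ (Ordinal (ltnW hn)) (Ordinal (ltnW hn)))/eqP.
    by rewrite !mxE eqxx eq_sym oner_eq0.
  have [t Ft] : exists t, F j t i != 0.
    apply: contrapT => Ft; move/negP: Aij; apply; rewrite AE big1 // => t _.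
    have -> : F j t i = 0 by apply/eqP/contraT => h; case: Ft; exists t.
    by rewrite mulr0.
  apply: le_trans (Fbound j t i); rewrite -intr_norm (ler_int R 1).
  by rewrite -gtz0_ge1 normr_gt0.
have Bbound i j : `|(B i j)%:~R| <= M * `|A|.
  by have [t [u ->]] := BF i; exact: Fbound.
have [Z [fZ BZ prodZ]] := siegel_le rB dl beta1 Bbound.
pose x i := A *m map_mx intr (row i Z)^T; exists x.
have xE i : x i = A *m (row i (map_mx intr Z))^T by rewrite -map_row map_trmx.
split.
- by move=> i; exists (row i Z)^T.
- apply/freeP => c cx i.
  have cxE : A *m ((\row_i c i) *m map_mx intr Z)^T = \sum_i c i *: x i.
    rewrite mulmx_sum_row raddf_sum mulmx_sumr; apply: eq_bigr => j _.
    by rewrite xE scalemxAr; congr (_ *m _); apply/colP => u; rewrite !mxE.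
  have : (\row_i c i) *m map_mx intr Z = 0 :> 'rV[R]_n.
    apply: trmx_inj; rewrite trmx0 -[LHS](mulKmx hA) cxE -[RHS](mulmx0 _ (invmx A)).
    congr (_ *m _); rewrite -[RHS]cx; apply: eq_bigr => j _.
    by rewrite -tnth_nth tnth_mktuple.
  rewrite -[RHS](mul0mx _ (map_mx intr Z)) => /(row_free_inj fZ)/rowP/(_ i).
  by rewrite !mxE.
(* The [n - k] coordinates indexed by [I] vanish, so the support lies in a set of [k] indices. *)
- move=> i; rewrite /norm0; apply: (@leq_trans #|~: I|).
    apply: subset_leq_card; apply/fintype.subsetP => u; rewrite !inE.
    apply: contra => uI; rewrite BA //.
    by rewrite tr_row colE mulmxA BZ mul0mx.
  by have := cardsC I; rewrite card_ord hI; lia.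
have A_ge0 : 0 <= `|A| by [].
have M_ge0 : 0 <= M.
  rewrite leNgt; apply: contraTN beta1 => M_lt0; rewrite -ltNge.
  by apply: le_lt_trans ltr01; rewrite mulr_le0_ge0 // ltW.
(* Squaring removes the half-integer exponent: [2 * n - d] equals [l + n] because [d + l] is [n]. *)
set P := _ `^ _.
have P2 : P ^+ 2 = n%:R ^+ (l + n) :> R.
  rewrite -powR_mulrn ?powR_ge0 // -powRrM -powR_mulrn //; congr (_ `^ _).
  by rewrite mulrBl divfK // -[in n%:R * 2]dl -[in RHS]dl !natrD; ring.
rewrite -(@ler_pXn2r _ 2) // ?nnegrE; first last.
- by rewrite !mulr_ge0 ?powR_ge0 ?exprn_ge0.
- by apply: prodr_ge0 => i _.
rewrite -prodrXl; apply: le_trans (_ : \prod_(i < l) (n%:R * `|A| ^+ 2 *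
  rdot (row i (map_mx intr Z)) (row i (map_mx intr Z))) <= _).
  by apply: ler_prod => i _; rewrite exprn_ge0 //= xE mulmx_norm_sqr_le.
rewrite big_split /= prodr_const card_ord.
apply: le_trans (ler_wpM2l _ prodZ) _; first by rewrite exprn_ge0 // mulr_ge0.
rewrite (exprMn _ _ (M ^+ d)) (exprMn _ P) P2 -[X in _ * (`|A| ^+ X) ^+ 2 * _]dl le_eqVlt.
by rewrite square_bound_eq eqxx.
Qed.
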